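(* Let $n\ge 5$, let $(c_i)_{i\in\mathbb Z}$ be the $n$-periodic quiddity sequence of a triangulated $n$-gon, indexed so that $c_0=1$, let $(C_{i,j}(q))$ be the associated $q$-deformed frieze, and let $(x_j)_{j\in\mathbb Z}$, $x_{j+n}=x_j$, be the associated $n$-gon in $\mathbb P^1(\mathbb Q)$ (all defined in the context). Then each entry of the second nontrivial row of the $q$-frieze is, up to an explicit monomial in $q$, the value of $\mathrm{gr}_q$ on four consecutive vertices of the $n$-gon; precisely, for every $i\in\mathbb Z$, $$C_{i,i+1}(q)=q^{\,c_i-1}\,\mathrm{gr}_q(x_{i-2},x_{i-1};x_i,x_{i+1}).$$
   Context: **$q$-rationals.** $[\,\cdot\,]_q:\mathbb P^1(\mathbb Q)=\mathbb Q\cup\{\infty\}\to\mathbb P^1(\mathbb Q(q))$ is the unique map with $[0]_q=0$, $[x+1]_q=q[x]_q+1$ and $[-1/x]_q=-1/(q[x]_q)$ for all $x\in\mathbb P^1(\mathbb Q)$ (usual conventions for $\infty$; in particular $[\infty]_q=\infty$). For an integer $c\ge1$, $[c]_q=1+q+\dots+q^{c-1}$. **Cross-ratios.** For four pairwise distinct points of $\mathbb P^1(\mathbb K)$ ($\mathbb K$ a field) with arbitrary nonzero lifts $X_i\in\mathbb K^2$ and $\Delta_{ij}=\det(X_i,X_j)$, set $\mathrm{cr}(x_1,x_2;x_3,x_4)=\frac{\Delta_{13}\Delta_{24}}{\Delta_{14}\Delta_{23}}$; in finite affine coordinates this is $\frac{(x_1-x_3)(x_2-x_4)}{(x_1-x_4)(x_2-x_3)}$.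 For pairwise distinct $x_1,\dots,x_4\in\mathbb P^1(\mathbb Q)$, $\mathrm{cr}_q(x_1,x_2;x_3,x_4)=\mathrm{cr}([x_1]_q,[x_2]_q;[x_3]_q,[x_4]_q)\in\mathbb Q(q)$, and $$\mathrm{gr}_q(x_1,x_2;x_3,x_4)=\frac{1}{\mathrm{cr}_q(x_1,x_2;x_3,x_4)-1}.$$ **$q$-frieze.** Let $(c_i)_{i\in\mathbb Z}$ be $n$-periodic, where $c_i$ is the number of triangles incident to the $i$-th vertex of a triangulated $n$-gon (vertices labelled cyclically modulo $n$); the labelling is chosen so that $c_0=1$ (vertex $0$ is an ear). The associated $q$-frieze is the array $C_{i,j}(q)$, $i\in\mathbb Z$, $i-1\le j\le i+n-3$ (so $n-1$ rows, the row index being $j-i$), determined by $C_{i,i-1}=1$, $C_{i,i}=[c_i]_q$ and the $q$-diamond rule $$C_{i,j-1}\,C_{i+1,j}-C_{i+1,j-1}\,C_{i,j}=q^{\sum_{k=i}^{j-1}(c_k-1)}\qquad(i+1\le j\le i+n-3).$$ The row $(C_{i,i})_i$ is the first nontrivial row and $(C_{i,i+1})_i$ is the second nontrivial row. **Associated $n$-gon.** Set $V_{-1}=\binom10$, $V_0=\binom11$ and define $V_j=\binom{\mathcal R_j(q)}{\mathcal S_j(q)}$ for all $j\in\mathbb Z$ by $V_j=[c_j]_qV_{j-1}-q^{c_{j-1}-1}V_{j-2}$ (used in both directions). The vertices are $x_j=\mathcal R_j(1)/\mathcal S_j(1)\in\mathbb P^1(\mathbb Q)$; for $0\le j\le n-2$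 this is the continued fraction $1-\cfrac1{c_1-\cfrac1{\ddots-\cfrac1{c_j}}}$, and $x_{-1}=\infty$. One has $x_{j+n}=x_j$, the points of one period are pairwise distinct, and $[x_j]_q=\mathcal R_j(q)/\mathcal S_j(q)$. *)

(* Defs.v *)
From HB Require Import structures.
From mathcomp Require Import all_boot all_order all_algebra.
From mathcomp Require Import ring lra zify.

Set Implicit Arguments.
Unset Strict Implicit.
Unset Printing Implicit Defensive.

Import Order.TTheory GRing.Theory Num.Theory.
Local Open Scope ring_scope.

(** * Projective lines *)

(* [Some x] is a finite point, [None] is infinity. *)
Definition P1 (K : fieldType) : Type := option K.

Definition col2 (K : fieldType) (a b : K) : 'cV[K]_2 :=
  \col_i (if i == 0 then a else b).

(* the point with homogeneous coordinates (a : b), for (a, b) != (0, 0) *)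
Definition point (K : fieldType) (a b : K) : P1 K :=
  if b == 0 then None else Some (a / b).

Definition lift_of (K : fieldType) (x : P1 K) : 'cV[K]_2 :=
  if x is Some a then col2 a 1 else col2 1 0.

(* x |-> a * x + b, for a != 0 *)
Definition aff (K : fieldType) (a b : K) (x : P1 K) : P1 K :=
  omap (fun y => a * y + b) x.

(* x |-> - 1 / x *)
Definition Ninv (K : fieldType) (x : P1 K) : P1 K :=
  if x is Some a then if a == 0 then None else Some (- a^-1) else Some 0.

Definition Delta (K : fieldType) (X Y : 'cV[K]_2) : K :=
  \det (row_mx X Y : 'M[K]_2).

Definition cr_lift (K : fieldType) (X1 X2 X3 X4 : 'cV[K]_2) : K :=
  (Delta X1 X3 * Delta X2 X4) / (Delta X1 X4 * Delta X2 X3).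

(* Only meaningful for pairwise distinct points. The choice of lifts is
   irrelevant, see [cr_liftZ]. *)
Definition cr (K : fieldType) (x1 x2 x3 x4 : P1 K) : K :=
  cr_lift (lift_of x1) (lift_of x2) (lift_of x3) (lift_of x4).

Lemma DeltaE (K : fieldType) (X Y : 'cV[K]_2) :
  Delta X Y = X 0 0 * Y 1 0 - Y 0 0 * X 1 0.
Proof.
rewrite /Delta; set M : 'M[K]_2 := row_mx X Y.
have M0 i : M i 0 = X i 0.
  have -> : (0 : 'I_2) = lshift 1 (0 : 'I_1) by apply/val_inj.
  exact: row_mxEl.
have M1 i : M i 1 = Y i 0.
  have -> : (1 : 'I_2) = rshift 1 (0 : 'I_1) by apply/val_inj.
  exact: row_mxEr.
clearbody M.
rewrite (expand_det_row _ 0) big_ord_recl big_ord1 /cofactor !det_mx11 !mxE /=.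
have -> : lift (0 : 'I_2) (0 : 'I_1) = 1 by apply/val_inj.
have -> : lift (1 : 'I_2) (0 : 'I_1) = 0 by apply/val_inj.
by rewrite !M0 !M1 /= expr0 expr1; ring.
Qed.

Lemma cr_liftZ (K : fieldType) (a1 a2 a3 a4 : K) (X1 X2 X3 X4 : 'cV[K]_2) :
    a1 != 0 -> a2 != 0 -> a3 != 0 -> a4 != 0 ->
  cr_lift (a1 *: X1) (a2 *: X2) (a3 *: X3) (a4 *: X4) = cr_lift X1 X2 X3 X4.
Proof.
move=> ha1 ha2 ha3 ha4; rewrite /cr_lift.
have DZ (u v : K) (Y Z : 'cV[K]_2) :
    Delta (u *: Y) (v *: Z) = (u * v) * Delta Y Z.
  by rewrite !DeltaE !mxE; ring.
rewrite !DZ.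
have m0 : a1 * a4 * (a2 * a3) != 0 by rewrite !mulf_neq0.
set D13 := Delta X1 X3; set D24 := Delta X2 X4.
set D14 := Delta X1 X4; set D23 := Delta X2 X3.
rewrite (_ : _ * D13 * _ = a1 * a4 * (a2 * a3) * (D13 * D24)); last by ring.
rewrite (_ : _ * D14 * _ = a1 * a4 * (a2 * a3) * (D14 * D23)); last by ring.
by rewrite -mulf_div divff ?mul1r.
Qed.

(** * The field Q(q) *)

Definition Qq : fieldType := {fraction {poly rat}}.

Definition q : Qq := FracField.tofrac ('X : {poly rat}).

(* Value at a of a rational function. The fraction chosen by [repr] need not be
   reduced, hence the division by the gcd; cf. [evalqE]. *)
Definition evalq (a : rat) (f : Qq) : rat :=
  let r : {ratio {poly rat}} := repr (f : {fraction {poly rat}}) in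
  let g := gcdp \n_r \d_r in
  (\n_r %/ g).[a] / (\d_r %/ g).[a].

Definition qint (c : nat) : Qq := \sum_(k < c) q ^+ k.

Lemma q_neq0 : q != 0.
Proof. by rewrite /q tofrac_eq0 polyX_eq0. Qed.

Lemma fracE (x : {fraction {poly rat}}) :
  x * FracField.tofrac \d_(repr x) = FracField.tofrac \n_(repr x).
Proof.
rewrite -[X in X * _]reprK; unlock FracField.tofrac.
rewrite -[LHS]FracField.pi_mul; apply/eqmodP => /=.
rewrite FracField.equivfE /FracField.mulf /=.
by rewrite !numden_Ratio ?mulr1 ?mulf_neq0 ?oner_neq0 ?denom_ratioP // mulrC.
Qed.

Lemma evalqE (a : rat) (u v : {poly rat}) : v.[a] != 0 ->
  evalq a (FracField.tofrac u / FracField.tofrac v) = u.[a] / v.[a].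
Proof.
move=> va0; have v0 : v != 0 by apply: contraNneq va0 => ->; rewrite horner0.
rewrite /evalq; set f := (X in repr X).
have := fracE f; set r := repr f; set n := \n_r; set d := \d_r => fd.
have d0 : d != 0 by exact: denom_ratioP.
have e : u * d = n * v.
  apply/eqP; rewrite -tofrac_eq !rmorphM /= -fd /f; apply/eqP.
  have tv0 : FracField.tofrac v != 0 by rewrite tofrac_eq0.
  by rewrite [RHS]mulrAC divfK.
set g := gcdp n d.
have g0 : g != 0 by rewrite gcdp_eq0 negb_and d0 orbT.
have nE : n = (n %/ g) * g by rewrite divpK // dvdp_gcdl.
have dE : d = (d %/ g) * g by rewrite divpK // dvdp_gcdr.
have cop : coprimep (n %/ g) (d %/ g) by rewrite coprimep_div_gcd // d0 orbT.
have e' : u * (d %/ g) = (n %/ g) * v.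
  by apply: (mulIf g0); rewrite -mulrA -dE e {1}nE mulrAC.
have dv : d %/ g %| v.
  by rewrite -(Gauss_dvdpr _ (_ : coprimep _ (n %/ g))) 1?coprimep_sym // -e'
     dvdp_mull.
have da0 : (d %/ g).[a] != 0.
  by apply: contraNneq va0 => h; rewrite -(divpK dv) hornerM h mulr0.
apply/eqP; rewrite eqr_div // -!hornerM -e'; apply/eqP; congr _.[a]; ring.
Qed.

(** * q-rationals *)

Definition is_q_rational (f : P1 rat -> P1 Qq) : Prop :=
  [/\ f (Some 0) = Some 0,
      forall x, f (aff 1 1 x) = aff q 1 (f x) &
      forall x, f (Ninv x) = Ninv (aff q 0 (f x))].

(* Existence and uniqueness of the map above, via the expansions
   x = m - 1/y with m = ceil x and y > 1 or y infinite; [k] bounds the length of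
   such an expansion. *)
Section QRationalConstruction.

Variables (K : fieldType) (t : K).
Hypothesis t0 : t != 0.

Let T (y : P1 K) := aff t 1 y.
Let T' (y : P1 K) := aff t^-1 (- t^-1) y.
Let S (y : P1 K) := Ninv (aff t 0 y).

Let TK : cancel T T'.
Proof. by case=> [y|]; rewrite /T /T' //=; congr Some; field. Qed.

Let T'K : cancel T' T.
Proof. by case=> [y|]; rewrite /T /T' //=; congr Some; field. Qed.

Let S0 : S (Some 0) = None.
Proof. by rewrite /S /= mulr0 addr0 eqxx. Qed.

Let SN y : y != 0 -> S (Some y) = Some (- (t * y)^-1).
Proof. by move=> y0; rewrite /S /= addr0 mulf_eq0 (negPf t0) (negPf y0). Qed.

Let N1 : (-1 : K) != 0.
Proof. by rewrite oppr_eq0 oner_neq0. Qed.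

Let SK : involutive S.
Proof.
case=> [y|]; last exact: S0.
have [->|y0] := eqVneq y 0; first by rewrite S0.
rewrite SN // SN ?oppr_eq0 ?invr_eq0 ?mulf_neq0 //.
by congr Some; field; rewrite y0 t0 N1.
Qed.

Let braid y : T' (S (T' (S (T' y)))) = S y.
Proof.
have T'E z : T' (Some z) = Some ((z - 1) / t) by congr Some; ring.
have t1 : - t^-1 != 0 by rewrite oppr_eq0 invr_eq0.
case: y => [y|]; last first.
  change (T' (S (T' (Some 0))) = Some 0).
  by rewrite T'E sub0r mulN1r SN // T'E; congr Some; field; rewrite ?t0 ?N1.
rewrite T'E; have [->|y1] := eqVneq y 1.
  rewrite subrr mul0r S0 SN ?oner_neq0 //.
  by change (T' (Some 0) = Some (- (t * 1)^-1)); rewrite T'E; congr Some; field; rewrite ?t0 ?N1.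
have yt0 : (y - 1) / t != 0 by rewrite mulf_neq0 ?invr_eq0 ?subr_eq0.
have y10 : y - 1 != 0 by rewrite subr_eq0.
rewrite SN // T'E; have [->|y0] := eqVneq y 0.
  by rewrite S0 (_ : (_ - 1) / t = 0) ?S0 //; field; rewrite ?t0 ?sub0r N1.
rewrite SN; last first.
  rewrite (_ : _ / t = - y / ((y - 1) * t)); last by field; rewrite ?y10 ?t0.
  by rewrite !mulf_neq0 ?oppr_eq0 ?invr_eq0 ?mulf_neq0.
rewrite T'E SN //; congr Some; field.
rewrite y0 t0 y10 /= (_ : -1 + _ = - y) ?oppr_eq0 //; ring.
Qed.

Let Tz (m : int) (y : P1 K) : P1 K :=
  match m with Posz k => iter k T y | Negz k => iter k.+1 T' y end.

Let TzS m y : Tz (m + 1) y = T (Tz m y).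
Proof.
case: m => [k|[|k]]; first by rewrite addrC.
  by rewrite /= T'K.
by rewrite (_ : Negz k.+1 + 1 = Negz k) ?[RHS]T'K //; lia.
Qed.

Let ratinv (r : rat) : P1 rat := if r == 0 then None else Some r^-1.

Fixpoint qrat_iter (k : nat) (x : P1 rat) : P1 K :=
  match k, x with
  | k'.+1, Some a =>
      Tz (Num.ceil a) (S (qrat_iter k' (ratinv ((Num.ceil a)%:~R - a))))
  | _, _ => None
  end.

Definition qrat_fun (x : P1 rat) : P1 K :=
  qrat_iter (if x is Some a then `|denq a|%N else 0%N) x.

Let stepE (a : int) (b : nat) : (0 < b)%N ->
  exists (r : nat), [/\ (r < b)%N,
    (Num.ceil (a%:Q / b%:Q))%:~R - a%:Q / b%:Q = r%:Q / b%:Q &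
    ratinv (r%:Q / b%:Q) = if r is 0 then None else Some (b%:Q / r%:Q)].
Proof.
move=> b0; have b0' : b%:Q != 0 by rewrite intr_eq0; lia.
have b0'' : 0 < b%:Q by rewrite ltr0z; lia.
set x := _ / _; set m := Num.ceil x.
have rE : m%:~R - x = (m * b%:Z - a)%:~R / b%:Q.
  by rewrite /x rmorphB rmorphM /= mulrBl mulfK.
have /andP[lo hi] : (m - 1)%:~R < x <= m%:~R := ceil_itv x.
have ge0 : 0 <= m * b%:Z - a.
  by rewrite -(ler0z rat) -(pmulr_lge0 _ (_ : 0 < b%:Q^-1)) ?invr_gt0 //
     -rE subr_ge0.
have ltb : m * b%:Z - a < b%:Z.
  rewrite -(ltr_int rat) -[ltRHS]mul1r -ltr_pdivrMr // -rE.
  by move: lo; rewrite rmorphB /=; lra.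
pose z := m * b%:Z - a; exists `|z|%N; rewrite -/z in rE ge0 ltb *; split; [by lia | by rewrite rE gez0_abs |].
rewrite /ratinv; case: `|_|%N => [|r]; first by rewrite mul0r eqxx.
rewrite mulf_eq0 invr_eq0 (negPf b0') orbF intr_eq0 /=; congr Some.
by rewrite invf_div.
Qed.

Let iter_enough k l (a : int) (b : nat) : (0 < b)%N -> (b <= k)%N ->
  (b <= l)%N -> qrat_iter k (Some (a%:Q / b%:Q)) = qrat_iter l (Some (a%:Q / b%:Q)).
Proof.
elim: k l a b => [|k IH] [|l] a b b0 bk bl; [by lia | by lia | by lia |].
rewrite /=; have [r [rb -> ->]] := stepE a b0.
case: r rb => [|r] rb; first by case: k {IH bk} => [|k]; case: l {bl}.
by rewrite (IH l b%:Z r.+1) //; lia.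
Qed.

Let qratE k (a : int) (b : nat) : (0 < b)%N -> (b <= k)%N ->
  qrat_fun (Some (a%:Q / b%:Q)) = qrat_iter k (Some (a%:Q / b%:Q)).
Proof.
move=> b0 bk; set x := a%:Q / b%:Q.
have xE : x = (numq x)%:Q / `|denq x|%N%:Q by rewrite absz_denq divq_num_den.
have d0 : (0 < `|denq x|)%N by rewrite absz_gt0 denq_neq0.
rewrite /qrat_fun {2}xE (@iter_enough _ (maxn k `|denq x|)%N) ?leq_maxr //.
by rewrite -xE; apply: iter_enough => //; rewrite leq_max bk.
Qed.

Let qrat_step (x : rat) :
  qrat_fun (Some x) =
    Tz (Num.ceil x) (S (qrat_fun (ratinv ((Num.ceil x)%:~R - x)))).
Proof.
have xE : x = (numq x)%:Q / `|denq x|%N%:Q by rewrite absz_denq divq_num_den.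
have d0 : (0 < `|denq x|)%N by rewrite absz_gt0 denq_neq0.
rewrite xE; move: (numq x) `|denq x|%N d0 => {xE} a b d0.
rewrite (@qratE b.+1) //=; have [r [rb -> ->]] := stepE a d0.
case: r rb => [|r] rb; first by case: b {d0 rb}.
by rewrite -(@qratE b b%:Z r.+1) //; lia.
Qed.

Let qrat_None : qrat_fun None = None. Proof. by []. Qed.

Let qrat_0 : qrat_fun (Some 0) = Some 0.
Proof. by rewrite qrat_step ceil0 subrr /ratinv eqxx. Qed.

Let qrat_T x : qrat_fun (aff 1 1 x) = T (qrat_fun x).
Proof.
case: x => [x|] //; rewrite [aff _ _ _]/= mul1r !qrat_step.
by rewrite ceilDrz ?intr_int1 // ceil1 TzS rmorphD /= opprD addrACA subrr addr0.
Qed.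

Let qrat_T1 x : qrat_fun (Some (x + 1)) = T (qrat_fun (Some x)).
Proof. by rewrite -qrat_T /= mul1r. Qed.

Let qrat_S_gt1 x : 1 < x -> qrat_fun (Some (- x^-1)) = S (qrat_fun (Some x)).
Proof.
move=> x1; have x0 : 0 < x by lra.
have c0 : Num.ceil (- x^-1) = 0.
  by apply: ceil_def; rewrite sub0r ltrN2 oppr_le0 invr_ge0 invf_lt1 // x1 ltW.
by rewrite qrat_step c0 sub0r opprK /ratinv invr_eq0 gt_eqF // invrK.
Qed.

Let qrat_S_pos k (a b : nat) : (a + b <= k)%N -> (0 < a)%N -> (0 < b)%N ->
  qrat_fun (Some (- (a%:Q / b%:Q)^-1)) = S (qrat_fun (Some (a%:Q / b%:Q))).
Proof.
elim: k a b => [|k IH] a b abk a0 b0; first by lia.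
have b0' : 0 < b%:Q by rewrite ltr0z; lia.
have [lt_ba|le_ab] := ltnP b a.
  by apply: qrat_S_gt1; rewrite ltr_pdivlMr // mul1r ltr_int; lia.
move: le_ab; rewrite leq_eqVlt => /orP[/eqP ->|lt_ab].
  have q1 : qrat_fun (Some 1) = Some 1.
    by rewrite -[in LHS](add0r 1) qrat_T1 qrat_0; congr Some; ring.
  rewrite divff ?gt_eqF // invr1 q1 -[LHS]TK -qrat_T1 addNr qrat_0.
  by rewrite SN ?oner_neq0 //; congr Some; field; rewrite ?t0 ?N1.
set x := a%:Q / b%:Q; pose z := a%:Q / (b - a)%N%:Q.
have a0' : 0 < a%:Q by rewrite ltr0z; lia.
have ba0 : 0 < b%:Q - a%:Q by rewrite -rmorphB ltr0z; lia.
have baE : (b - a)%N%:Q = b%:Q - a%:Q.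
  by rewrite -rmorphB /=; congr (_%:~R); lia.
have IHz : qrat_fun (Some (- z^-1)) = S (qrat_fun (Some z)).
  by apply: IH; lia.
have x0 : 0 < x by rewrite divr_gt0.
have x1 : x < 1 by rewrite ltr_pdivrMr // mul1r -subr_gt0.
have zE : z + 1 = (1 - x)^-1.
  by rewrite /z /x baE; field; rewrite !gt_eqF.
have xzE : - x^-1 + 1 = - z^-1.
  by rewrite /z /x baE; field; rewrite !gt_eqF.
have fz : qrat_fun (Some z) = T' (S (T' (qrat_fun (Some x)))).
  rewrite -[LHS]TK -qrat_T1 zE; congr T'.
  rewrite -[LHS]SK -qrat_S_gt1 ?invrK; last by rewrite invf_gt1; lra.
  by rewrite -[X in S X]TK -qrat_T1; congr (S (T' (qrat_fun (Some _)))); lra.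
by rewrite -[LHS]TK -qrat_T1 xzE IHz fz braid.
Qed.

Let qrat_S_gt0 x : 0 < x -> qrat_fun (Some (- x^-1)) = S (qrat_fun (Some x)).
Proof.
move=> x0; have n0 : (0 < numq x)%R by rewrite numq_gt0.
rewrite -(divq_num_den x) -(gez0_abs (ltW n0)) -absz_denq.
by apply: qrat_S_pos; rewrite // absz_gt0 ?denq_neq0 ?gt_eqF.
Qed.

Let qrat_S x : qrat_fun (Ninv x) = S (qrat_fun x).
Proof.
case: x => [x|]; last exact: qrat_0.
rewrite /Ninv; have [x0|x0|->] := ltgtP x 0; last by rewrite qrat_0 S0.
- apply: (can_inj SK); rewrite SK -qrat_S_gt0 ?oppr_gt0 ?invr_lt0 //.
  by rewrite invrN invrK opprK.
- exact: qrat_S_gt0.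
Qed.

Lemma qrat_fun_spec :
  [/\ qrat_fun (Some 0) = Some 0,
      forall x, qrat_fun (aff 1 1 x) = aff t 1 (qrat_fun x) &
      forall x, qrat_fun (Ninv x) = Ninv (aff t 0 (qrat_fun x))].
Proof. by split; [exact: qrat_0 | exact: qrat_T | exact: qrat_S]. Qed.

Lemma qrat_fun_unique (f : P1 rat -> P1 K) :
    [/\ f (Some 0) = Some 0,
      forall x, f (aff 1 1 x) = aff t 1 (f x) &
      forall x, f (Ninv x) = Ninv (aff t 0 (f x))] ->
  f =1 qrat_fun.
Proof.
case=> f0 fT fS.
have fN : f None = None by have := fS (Some 0); rewrite f0 -/(S _) S0 {1}/Ninv eqxx.
have fT1 x : f (Some (x + 1)) = T (f (Some x)) by rewrite /T -fT /= mul1r.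
have fTz m x : f (Some (x + m%:~R)) = Tz m (f (Some x)).
  elim/int_ind: m => [|m|m]; first by rewrite addr0.
    by rewrite -addn1 PoszD TzS rmorphD addrA fT1 => ->.
  move=> h; rewrite -[RHS]TK -TzS -[LHS]TK -fT1 -addrA.
  rewrite (_ : - m.+1%:Z + 1 = - m%:Z); last by lia.
  rewrite -h; congr (T' (f (Some (_ + _)))).
  by rewrite -[1]/(1%:~R) -rmorphD; congr (_%:~R); lia.
have fP x : f (Some x) = Tz (Num.ceil x) (S (f (ratinv ((Num.ceil x)%:~R - x)))).
  rewrite /S -fS /ratinv; set m := Num.ceil x.
  have xE : x = (x - m%:~R) + m%:~R by rewrite subrK.
  rewrite {1}xE fTz; congr Tz; congr f.
  by rewrite -[x - _]opprB; case: eqVneq => [->|r0] /=;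
     rewrite ?oppr0 // invr_eq0 (negPf r0) invrK.
move=> [x|] //; rewrite -(divq_num_den x) -absz_denq.
have : (0 < `|denq x|)%N by rewrite absz_gt0 denq_neq0.
move: {2}`|denq x|%N (leqnn `|denq x|%N) => k.
elim: k (numq x) `|denq x|%N => [|k IH] a b bk b0; first by lia.
rewrite fP qrat_step; have [r [rb -> ->]] := stepE a b0.
by case: r rb => [|r] rb; rewrite ?fN // (IH b%:Z r.+1) //; lia.
Qed.

End QRationalConstruction.

Lemma q_rational_sig : {f | is_q_rational f}.
Proof. by exists (qrat_fun q); exact: (qrat_fun_spec q_neq0). Qed.

(* [qrat x] is the q-rational [x]_q, see [qratP] and [qrat_unique]. *)
Definition qrat : P1 rat -> P1 Qq := sval q_rational_sig.

Lemma qratP : is_q_rational qrat.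
Proof. exact: (svalP q_rational_sig). Qed.

Lemma qrat_unique f : is_q_rational f -> f =1 qrat.
Proof.
move=> hf x; rewrite (qrat_fun_unique q_neq0 hf).
by rewrite (qrat_fun_unique q_neq0 qratP).
Qed.

Definition cr_q (x1 x2 x3 x4 : P1 rat) : Qq :=
  cr (qrat x1) (qrat x2) (qrat x3) (qrat x4).

Definition gr_q (x1 x2 x3 x4 : P1 rat) : Qq := 1 / (cr_q x1 x2 x3 x4 - 1).

(** * Triangulated polygons *)

(* The vertices of the n-gon are 0, ..., n-1 in cyclic order; a segment {a, b}
   is encoded by the pair (a, b) with a < b. *)
Section Triangulation.

Variable n : nat.

Definition side (a b : 'I_n) : bool :=
  (b == a.+1 :> nat) || ((a == 0 :> nat) && (b == n.-1 :> nat)).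

Definition diagonals : {set 'I_n * 'I_n} :=
  [set e : 'I_n * 'I_n | (e.1 < e.2)%N && ~~ side e.1 e.2].

Definition crossing (e f : 'I_n * 'I_n) : bool :=
  [&& e.1 < f.1, f.1 < e.2 & e.2 < f.2]%N ||
  [&& f.1 < e.1, e.1 < f.2 & f.2 < e.2]%N.

Definition noncrossing (D : {set 'I_n * 'I_n}) : bool :=
  (D \subset diagonals) && [forall e in D, forall f in D, ~~ crossing e f].

Definition triangulation (D : {set 'I_n * 'I_n}) : bool := maxset noncrossing D.

Definition triangles (D : {set 'I_n * 'I_n}) : {set {set 'I_n}} :=
  [set t : {set 'I_n} | (#|t| == 3) &&
    [forall a in t, forall b in t,
       (a < b)%N ==> (side a b || ((a, b) \in D))]].

Definition incident_triangles (D : {set 'I_n * 'I_n}) (v : 'I_n) : nat :=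
  #|[set t in triangles D | v \in t]|.

End Triangulation.

(* n-periodicity is part of the labelling by residues modulo n *)
Definition quiddity_sequence (n : nat) (c : int -> nat) : Prop :=
  exists2 D : {set 'I_n * 'I_n}, triangulation D &
    forall (i : int) (v : 'I_n),
      (i = v%:Z %[mod n%:Z])%Z -> c i = incident_triangles D v.

(** * q-friezes and the associated n-gon *)

(* Only the entries C i j with i - 1 <= j <= i + n - 3 are constrained. *)
Definition is_q_frieze (n : nat) (c : int -> nat) (C : int -> int -> Qq) : Prop :=
  [/\ forall i, C i (i - 1) = 1,
      forall i, C i i = qint (c i) &
      forall i j, i + 1 <= j <= i + n%:Z - 3 ->
        C i (j - 1) * C (i + 1) j - C (i + 1) (j - 1) * C i j =
        q ^ (\sum_(k < absz (j - i)%R) ((c (i + k%:Z))%:Z - 1))].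

Definition is_polygon_lift (c : int -> nat) (V : int -> 'cV[Qq]_2) : Prop :=
  [/\ V (-1) = col2 1 0,
      V 0 = col2 1 1 &
      forall j, V j = qint (c j) *: V (j - 1)
                      - q ^ ((c (j - 1))%:Z - 1) *: V (j - 2)].

Definition vertex (V : int -> 'cV[Qq]_2) (j : int) : P1 rat :=
  point (evalq 1 (V j 0 0)) (evalq 1 (V j 1 0)).

Lemma q_frieze_exists n c : exists C, is_q_frieze n c C.
Proof.
pose K := fix K i (m : nat) : Qq * Qq := (* (C i (i + m - 1), C i (i + m)) *)
  if m is m'.+1 then
    let: (a, b) := K i m' in
    (b, qint (c (i + m%:Z)) * b - q ^ ((c (i + m'%:Z))%:Z - 1) * a)
  else (1, qint (c i)).
have K1 i m : (K i m.+1).1 = (K i m).2 by rewrite /=; case: (K i m).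
have K2 i m : (K i m.+1).2 = qint (c (i + m.+1%:Z)) * (K i m).2
    - q ^ ((c (i + m%:Z))%:Z - 1) * (K i m).1.
  by rewrite /=; case: (K i m).
exists (fun i j => (K i (absz (j - i + 1)%R)).1); split=> [i|i|i j /andP[ij _]].
- by rewrite (_ : absz _ = 0%N) //; lia.
- by rewrite (_ : absz _ = 1%N) //; lia.
have [m jE] : exists m : nat, j = i + m.+1%:Z by exists (absz (j - i - 1)%R); lia.
rewrite {}jE {ij}.
rewrite (_ : absz (i + m.+1%:Z - 1 - i + 1)%R = m.+1); last by lia.
rewrite (_ : absz (i + m.+1%:Z - (i + 1) + 1)%R = m.+1); last by lia.
rewrite (_ : absz (i + m.+1%:Z - 1 - (i + 1) + 1)%R = m); last by lia.
rewrite (_ : absz (i + m.+1%:Z - i + 1)%R = m.+2); last by lia.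
rewrite (_ : absz (i + m.+1%:Z - i)%R = m.+1); last by lia.
elim: m => [|m IH].
  by rewrite big_ord1 !K1 K2 /= !addr0; ring.
rewrite (_ : \sum_(k < m.+2) _ = \sum_(k < m.+1) ((c (i + k%:Z))%:Z - 1)
    + ((c (i + m.+1%:Z))%:Z - 1)); last exact: big_ord_recr.
rewrite expfzDr ?q_neq0 // -IH.
rewrite !K1 (K2 i m.+1) (K2 (i + 1) m) !K1.
rewrite (_ : i + 1 + m.+1%:Z = i + m.+2%:Z); last by lia.
rewrite (_ : i + 1 + m%:Z = i + m.+1%:Z); last by lia.
by ring.
Qed.

Lemma polygon_lift_exists c : exists V, is_polygon_lift c V.
Proof.
pose P := fix P (m : nat) := (* (V (m - 1), V m) *)
  if m is m'.+1 then
    let: (a, b) := P m' in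
    (b, qint (c m%:Z) *: b - q ^ ((c m'%:Z)%:Z - 1) *: a)
  else (col2 1 0 : 'cV[Qq]_2, col2 1 1).
pose N := fix N (m : nat) := (* (V (- m - 1), V (- m)) *)
  if m is m'.+1 then
    let: (a, b) := N m' in
    (q ^ (1 - (c (- m%:Z))%:Z) *: (qint (c (- m'%:Z)) *: a - b), a)
  else (col2 1 0 : 'cV[Qq]_2, col2 1 1).
exists (fun j => match j with Posz m => (P m).2 | Negz m => (N m).1 end).
split=> // j.
have P1E m : (P m.+1).1 = (P m).2 by rewrite /=; case: (P m).
have P2E m : (P m.+1).2 = qint (c m.+1%:Z) *: (P m).2
    - q ^ ((c m%:Z)%:Z - 1) *: (P m).1 by rewrite /=; case: (P m).
have N2E m : (N m.+1).2 = (N m).1 by rewrite /=; case: (N m).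
have NE m : (N m).2 = qint (c (- m%:Z)) *: (N m).1
    - q ^ ((c (- m.+1%:Z))%:Z - 1) *: (N m.+1).1.
  rewrite /=; case: (N m) => a b /=; rewrite scalerA -expfzDr ?q_neq0 //.
  rewrite (_ : _ - 1 + (1 - _) = 0); last by lia.
  by rewrite expr0z scale1r opprB addrC subrK.
case: j => [[|[|m]]|m].
- exact: (NE 0%N).
- exact: (P2E 0%N).
- rewrite (_ : m.+2%:Z - 1 = m.+1%:Z); last by lia.
  rewrite (_ : m.+2%:Z - 2 = m%:Z); last by lia.
  by rewrite P2E P1E.
- rewrite (_ : Negz m - 1 = Negz m.+1); last by lia.
  rewrite (_ : Negz m - 2 = Negz m.+2); last by lia.
  by rewrite -N2E NE !NegzE.
Qed.

(* Main.v *)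
(** Writing A(c) for the matrix (([c]_q, -q^(c-1)), (1, 0)), the recursion says
    that V_j is the first column of A(c_0) ... A(c_j), since c_0 = 1. Each A(c)
    is a multiple of T_q^c S_q, so that V_j is a lift of [x_j]_q. The recursion
    expresses all the determinants in the cross-ratio through
    det(V_(i-2), V_(i-1)), and one gets
    gr_q = ([c_i]_q [c_(i+1)]_q - q^(c_i-1)) / q^(c_i-1), provided that the
    numerator, which is C_(i,i+1) by the diamond rule, does not vanish. At q = 1
    it is c_i c_(i+1) - 1, which is nonzero because two neighbouring vertices of
    a triangulated polygon cannot both be ears. *)
Require Import Defs.
From mathcomp Require Import all_boot all_order all_algebra.
From mathcomp Require Import ring zify.
Set Implicit Arguments.
Unset Strict Implicit.
Import Order.TTheory GRing.Theory Num.Theory.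
Local Open Scope ring_scope.

Lemma int_ind_succ_pred (P : int -> Prop) :
  P 0 -> (forall j, P j -> P (j + 1)) -> (forall j, P j -> P (j - 1)) ->
  forall j, P j.
Proof.
move=> P0 Pup Pdown; elim/int_ind => [//|m Pm|m Pm].
  by rewrite (_ : m.+1%:Z = m%:Z + 1); [exact: Pup | lia].
by rewrite (_ : - m.+1%:Z = - m%:Z - 1); [exact: Pdown | lia].
Qed.

(** * Evaluation of rational functions *)

(** Says that [f] is regular at [a] with value [x]. Unlike [evalq], which picks a representative,
    this relation is visibly compatible with the field operations. *)
Definition takes (a : rat) (f : Qq) (x : rat) : Prop :=
  exists u v : {poly rat}, [/\ v.[a] != 0,
    f = FracField.tofrac u / FracField.tofrac v & x = u.[a] / v.[a]].

Lemma takes_evalq a f x : takes a f x -> evalq a f = x.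
Proof. by case=> u [v [va -> ->]]; exact: evalqE. Qed.

Lemma takesP a f x : takes a f x -> takes a f (evalq a f).
Proof. by move=> h; rewrite (takes_evalq h). Qed.

Lemma takes_poly a (p : {poly rat}) : takes a (FracField.tofrac p) p.[a].
Proof. by exists p, 1; rewrite hornerC oner_neq0 rmorph1 !divr1. Qed.

Lemma takes0 a : takes a 0 0.
Proof. by have := takes_poly a 0; rewrite horner0 rmorph0. Qed.

Lemma horner_neq0 (a : rat) (p : {poly rat}) : p.[a] != 0 -> p != 0.
Proof. by apply: contraNneq => ->; rewrite horner0. Qed.

Lemma takesM a f g x y : takes a f x -> takes a g y -> takes a (f * g) (x * y).
Proof.
case=> u [v [va -> ->]] [u' [v' [va' -> ->]]]; exists (u * u'), (v * v').
by rewrite !hornerM mulf_neq0 // !rmorphM /= !mulf_div.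
Qed.

Lemma takesD a f g x y : takes a f x -> takes a g y -> takes a (f + g) (x + y).
Proof.
case=> u [v [va -> ->]] [u' [v' [va' -> ->]]].
exists (u * v' + u' * v), (v * v').
rewrite !(hornerD, hornerM) mulf_neq0 // rmorphD !rmorphM /=.
by rewrite !addf_div // tofrac_eq0; apply: horner_neq0; eassumption.
Qed.

Lemma takesV a f x : x != 0 -> takes a f x -> takes a f^-1 x^-1.
Proof.
move=> x0 [u [v [va fE xE]]]; exists v, u; rewrite fE xE !invf_div; split=> //.
by apply: contraNneq x0 => ua; rewrite xE ua mul0r.
Qed.

Lemma takesN a f x : takes a f x -> takes a (- f) (- x).
Proof.
case=> u [v [va -> ->]]; exists (- u), v.
by rewrite hornerN rmorphN /= !mulNr.
Qed.

Lemma qX_neq0 k : q ^ k != 0.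
Proof. exact: (expfz_neq0 _ q_neq0). Qed.

Lemma takes_qX k : takes 1 (q ^ k) 1.
Proof.
have qn m : takes 1 (q ^+ m) 1.
  by have := takes_poly 1 ('X ^+ m); rewrite rmorphXn /= hornerXn expr1n.
case: k => m; first exact: qn.
by rewrite NegzE -exprnN -[X in takes _ _ X]invr1; apply: takesV.
Qed.

Lemma takes_qint c : takes 1 (qint c) c%:R.
Proof.
rewrite /qint; elim: c => [|c IH].
  by rewrite big_ord0; exact: takes0.
by rewrite big_ord_recr -natr1 /=; apply: takesD => //; exact: (takes_qX c).
Qed.

(** * Lifts of q-rationals *)

Section Point.

Variable K : fieldType.
Implicit Types a b k : K.

Lemma pointZ k a b : k != 0 -> point (k * a) (k * b) = point a b.
Proof.
move=> k0; rewrite /point mulf_eq0 (negPf k0) /=.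
by case: eqVneq => // b0; congr Some; rewrite -mulf_div divff ?mul1r.
Qed.

Lemma aff_point s a b : aff s 1 (point a b) = point (s * a + b) b.
Proof.
rewrite /point; case: eqVneq => //= b0; congr Some.
by rewrite mulrDl divff // mulrA.
Qed.

Lemma Ninv_point s a b : s != 0 -> (a, b) != (0, 0) ->
  Ninv (aff s 0 (point a b)) = point (- b) (s * a).
Proof.
move=> s0; rewrite xpair_eqE negb_and /point mulf_eq0 (negPf s0) /=.
case: (eqVneq b 0) => [->|b0]; first by rewrite orbF => /negPf-> /=; rewrite oppr0 mul0r.
move=> _ /=; rewrite addr0 !mulf_eq0 invr_eq0 (negPf s0) (negPf b0) orbF /=.
case: (eqVneq a 0) => [//|a0]; congr Some.
by rewrite mulrA invf_div mulNr.
Qed.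

Lemma lift_of_point a b : (a, b) != (0, 0) ->
  exists2 k, k != 0 & lift_of (point a b) = k *: col2 a b.
Proof.
rewrite xpair_eqE negb_and /point; case: (eqVneq b 0) => [->|b0] /=.
  rewrite orbF => a0; exists a^-1; first by rewrite invr_eq0.
  apply/matrixP=> i j; rewrite !mxE.
  by case: ifP; rewrite ?mulr0 // mulVf.
move=> _; exists b^-1; first by rewrite invr_eq0.
apply/matrixP=> i j; rewrite !mxE.
by case: ifP; rewrite ?mulVf // mulrC.
Qed.

End Point.

Section QLift.

Variables (K : fieldType) (s : K) (f : P1 rat -> P1 K).
Hypothesis s0 : s != 0.
Hypothesis fT : forall x, f (aff 1 1 x) = aff s 1 (f x).
Hypothesis fS : forall x, f (Ninv x) = Ninv (aff s 0 (f x)).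

(* (U : W) are homogeneous coordinates of the image of (u : v) *)
Definition qlift (u v : rat) (U W : K) : Prop :=
  [/\ (u, v) != (0, 0), (U, W) != (0, 0) & f (point u v) = point U W].

Lemma qliftZ k u v U W : k != 0 -> qlift u v U W -> qlift u v (k * U) (k * W).
Proof.
move=> k0 [uv UW e]; split=> //; last by rewrite pointZ.
by move: UW; rewrite !xpair_eqE !mulf_eq0 (negPf k0).
Qed.

Lemma qliftN u v U W : qlift u v U W -> qlift (- u) (- v) U W.
Proof.
case=> uv UW e; split=> //; first by move: uv; rewrite !xpair_eqE !oppr_eq0.
by rewrite -e -(@pointZ _ (-1)) ?oppr_eq0 ?oner_neq0 // !mulN1r !opprK.
Qed.

Lemma qlift_T u v U W : qlift u v U W -> qlift (u + v) v (s * U + W) W.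
Proof.
case=> uv UW e; split.
- by apply: contraNneq uv => -[/eqP + v0]; rewrite v0 addr0 => /eqP->.
- apply: contraNneq UW => -[/eqP + W0].
  by rewrite W0 addr0 mulf_eq0 (negPf s0) => /eqP->.
- by rewrite -aff_point -e -fT aff_point mul1r.
Qed.

Lemma qlift_T' u v U W : qlift u v U W -> qlift (u - v) v (s^-1 * (U - W)) W.
Proof.
case=> uv UW e; split.
- by apply: contraNneq uv => -[/eqP + v0]; rewrite v0 subr0 => /eqP->.
- apply: contraNneq UW => -[/eqP + W0].
  by rewrite W0 subr0 mulf_eq0 invr_eq0 (negPf s0) => /eqP->.
have aff_inj : injective (@aff K s 1).
  by move=> [x|] [y|] //= [/addIr/(mulfI s0)->].
apply: aff_inj; rewrite -fT !aff_point mul1r subrK e.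
by rewrite mulVKf // subrK.
Qed.

Lemma qlift_S u v U W : qlift u v U W -> qlift (- v) u (- W) (s * U).
Proof.
case=> uv UW e; split.
- by move: uv; rewrite !xpair_eqE oppr_eq0 andbC.
- by move: UW; rewrite !xpair_eqE oppr_eq0 mulf_eq0 (negPf s0) /= andbC.
- rewrite -Ninv_point // -e -fS; congr f.
  have -> : point u v = aff 1 0 (point u v).
    by rewrite /point; case: ifP => //= _; rewrite mul1r addr0.
  by rewrite Ninv_point ?oner_neq0 // mul1r.
Qed.

Let sint c := \sum_(k < c) s ^+ k.

(** With [T = ((s, 1), (0, 1))] and [S = ((0, -1), (s, 0))], the product [T^c S] is [s] times
    [(([c]_s, -s^(c-1)), (1, 0))]; the scalar [s] is removed by [qliftZ]. *)
Lemma qlift_A c u v U W : qlift u v U W ->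
  qlift (c%:R * u - v) u (sint c * U - s ^ (c%:Z - 1) * W) U.
Proof.
move=> h; have /(_ c) Tc : forall m, qlift (m%:R * u - v) u
    (sint m * (s * U) - s ^+ m * W) (s * U).
  elim=> [|m]; first by rewrite /sint big_ord0 !mul0r mul1r !sub0r; exact: qlift_S.
  have -> : sint m.+1 = s * sint m + 1.
    rewrite /sint big_ord_recl expr0 addrC mulr_sumr; congr (_ + _).
    by apply: eq_bigr => k _; rewrite exprS.
  by move/qlift_T; rewrite -natr1 exprS; congr qlift; ring.
have := @qliftZ s^-1 _ _ _ _ _ Tc; rewrite invr_eq0 s0 => /(_ isT).
rewrite expfzDr // mulKf //; congr qlift.
by rewrite mulrBr mulrCA mulKf // mulrA (mulrC s^-1).
Qed.

(** The inverse step, scaled by [s^(c-1)]: apply [T^-1] [c] times, then [S], which is projectively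
    an involution. *)
Lemma qlift_A' c u v U W : qlift u v U W ->
  qlift v (c%:R * v - u) (s ^ (c%:Z - 1) * W) (sint c * W - U).
Proof.
move=> h; have /(_ c) Tc : forall m, qlift (u - m%:R * v) v
    (s ^- m * (U - sint m * W)) W.
  elim=> [|m]; first by rewrite /sint big_ord0 !mul0r !subr0 expr0 invr1 mul1r.
  move/qlift_T'; rewrite -natr1; congr qlift; first by ring.
  have -> : sint m.+1 = sint m + s ^+ m by rewrite /sint big_ord_recr.
  by rewrite exprS; field; rewrite ?expf_neq0 ?s0.
have := qliftN (qlift_S Tc).
have k0 : - (s ^ (c%:Z - 1)) != 0 by rewrite oppr_eq0 expfz_neq0.
move/(qliftZ k0); rewrite expfzDr //; congr qlift.
- by rewrite opprK.
- by rewrite opprB.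
- by rewrite mulrNN.
- have -> : s ^ c%:Z = s ^+ c by [].
  have -> : s ^ (-1) = s^-1 by [].
  by field; rewrite ?expf_neq0 ?s0.
Qed.

(* The action on points of the matrix A(c_0) ... A(c_j), whose columns are V_j
   and - q^(c_j - 1) V_(j-1). *)
Lemma qlift_product (c : int -> nat) (x y : int -> rat) (X Y : int -> K) :
    c 0 = 1%N ->
    x (-1) = 1 -> y (-1) = 0 -> x 0 = 1 -> y 0 = 1 ->
    (forall j, x (j + 1) = (c (j + 1))%:R * x j - x (j - 1)) ->
    (forall j, y (j + 1) = (c (j + 1))%:R * y j - y (j - 1)) ->
    X (-1) = 1 -> Y (-1) = 0 -> X 0 = 1 -> Y 0 = 1 ->
    (forall j, X (j + 1) = sint (c (j + 1)) * X j - s ^ ((c j)%:Z - 1) * X (j - 1)) ->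
    (forall j, Y (j + 1) = sint (c (j + 1)) * Y j - s ^ ((c j)%:Z - 1) * Y (j - 1)) ->
  forall j u v U W, qlift u v U W ->
    qlift (u * x j - v * x (j - 1)) (u * y j - v * y (j - 1))
      (U * X j - s ^ ((c j)%:Z - 1) * W * X (j - 1))
      (U * Y j - s ^ ((c j)%:Z - 1) * W * Y (j - 1)).
Proof.
(* The product changes at its right end, so the factor added or removed acts first on the point;
   hence [(u : v)] stays general in the induction. *)
move=> c0 xN yN x0 y0 xE yE XN YN X0 Y0 XE YE.
elim/int_ind_succ_pred => [|j IH|j IH] u v U W h.
- rewrite sub0r xN yN XN YN x0 y0 X0 Y0 !mulr0 !mulr1 !subr0.
  by have := qlift_A 1 h; rewrite c0 mul1r /sint big_ord1 expr0 mul1r.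
- have := IH _ _ _ _ (qlift_A (c (j + 1)) h).
  rewrite addrK xE yE XE YE; congr qlift; ring.
- have := IH _ _ _ _ (qlift_A' (c j) h).
  have b0 : s ^ ((c j)%:Z - 1) != 0 by rewrite expfz_neq0.
  have k0 : (s ^ ((c j)%:Z - 1))^-1 != 0 by rewrite invr_eq0.
  have := (xE (j - 1), yE (j - 1), XE (j - 1), YE (j - 1)); rewrite subrK.
  case=> [[[-> ->] ->] ->] /(qliftZ k0).
  move: (s ^ ((c j)%:Z - 1)) b0 {k0} => b b0.
  congr qlift; [ring | ring | by field | by field].
Qed.

End QLift.

(** With [D = Delta X1 X2], the minors 13, 23, 24, 14 are [s D], [a D], [t a D], [(s t - b) D]. The
    cross-ratio is thus [s t / (s t - b)], and subtracting 1 leaves [b / (s t - b)]. *)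
Lemma cr_lift_recurrence (K : fieldType) (a b s t : K) (X1 X2 X3 X4 : 'cV[K]_2) :
    X3 = s *: X2 - a *: X1 -> X4 = t *: X3 - b *: X2 ->
    Delta X1 X2 != 0 -> a != 0 -> b != 0 -> s * t - b != 0 ->
  b * (1 / (cr_lift X1 X2 X3 X4 - 1)) = s * t - b.
Proof.
move=> X3E X4E D0 a0 b0 N0; rewrite /cr_lift; set D := Delta X1 X2 in D0.
have D13 : Delta X1 X3 = s * D by rewrite X3E /D !DeltaE !mxE; ring.
have D23 : Delta X2 X3 = a * D by rewrite X3E /D !DeltaE !mxE; ring.
have D24 : Delta X2 X4 = t * (a * D) by rewrite -D23 X4E !DeltaE !mxE; ring.
have D14 : Delta X1 X4 = (s * t - b) * D.
  by rewrite mulrBl (mulrC s) -mulrA -D13 X4E /D !DeltaE !mxE; ring.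
rewrite D13 D23 D24 D14; set N := s * t - b in N0 *.
have -> : s * D * (t * (a * D)) / (N * D * (a * D)) - 1 = b / N.
  have -> : b = s * t - N by rewrite /N; ring.
  by field; rewrite N0 D0 a0.
by field; rewrite N0 b0.
Qed.

(** * The associated polygon *)

Section Polygon.

Variables (c : int -> nat) (V : int -> 'cV[Qq]_2).
Hypotheses (c0 : c 0 = 1%N) (hV : is_polygon_lift c V).

Lemma lift_rec j k : V (j + 1) k 0 =
  qint (c (j + 1)) * V j k 0 - q ^ ((c j)%:Z - 1) * V (j - 1) k 0.
Proof.
have e : j + 1 - 2 = j - 1 by lia.
have [_ _ Vj] := hV; by rewrite Vj addrK e !mxE.
Qed.

Lemma lift_rec' j k : V (j - 1) k 0 =
  q ^ (- ((c j)%:Z - 1)) * (qint (c (j + 1)) * V j k 0 - V (j + 1) k 0).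
Proof.
by rewrite lift_rec subKr mulrA -expfzDr ?q_neq0 // addNr expr0z mul1r.
Qed.

(** In both directions the recursion only involves q-integers and powers of [q], all regular at 1.
    Two consecutive terms are carried because it has order two. *)
Lemma takes_lift k j : takes 1 (V j k 0) (evalq 1 (V j k 0)).
Proof.
suff [] : (exists x, takes 1 (V j k 0) x) /\ (exists x, takes 1 (V (j - 1) k 0) x).
  by case=> x /takesP.
have [V1 V0 _] := hV.
have t0 := takes0 1; have t1 : takes 1 1 1 := takes_qX 0.
elim/int_ind_succ_pred: j => [|j [[x hx] [y hy]]|j [[x hx] [y hy]]].
- rewrite V0 sub0r V1 !mxE.
  by split; [exists 1 | case: ifP => _; [exists 1 | exists 0]] => //; case: ifP.
- rewrite addrK lift_rec; split; last by exists x.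
  exists ((c (j + 1))%:R * x - 1 * y).
  by apply: takesD; [|apply: takesN]; apply: takesM => //;
    [exact: takes_qint | exact: takes_qX].
- have -> : V (j - 1 - 1) k 0 =
      q ^ (- ((c (j - 1))%:Z - 1)) * (qint (c j) * V (j - 1) k 0 - V j k 0).
    by rewrite lift_rec' subrK.
  split; first by exists y.
  exists (1 * ((c j)%:R * y - x)); apply: takesM; first exact: takes_qX.
  apply: takesD; last exact: takesN.
  by apply: takesM => //; exact: takes_qint.
Qed.

Lemma evalq_lift_rec j k : evalq 1 (V (j + 1) k 0) =
  (c (j + 1))%:R * evalq 1 (V j k 0) - evalq 1 (V (j - 1) k 0).
Proof.
apply: takes_evalq; rewrite lift_rec -[evalq 1 (V (j - 1) k 0)]mul1r.
by apply: takesD; [|apply: takesN]; apply: takesM; try exact: takes_lift;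
  [exact: takes_qint | exact: takes_qX].
Qed.

(** The matrix product applied to infinity [(1 : 0)] selects the first column, which is [V_j] over
    Q(q) and its value at [q = 1] over Q. *)
Lemma qlift_vertex j :
  (V j 0 0, V j 1 0) != (0, 0) /\ qrat (vertex V j) = point (V j 0 0) (V j 1 0).
Proof.
have [q0 qT qS] := qratP; have [V1 V0 _] := hV.
(* [[infinity]_q = infinity] comes from the inversion rule at 0. *)
have inf : qlift qrat 1 0 1 0.
  split; [by rewrite xpair_eqE oner_eq0 | by rewrite xpair_eqE oner_eq0 |].
  have := qS (Some 0); rewrite q0 /point eqxx /Ninv eqxx /aff /omap /obind /oapp.
  by rewrite mulr0 addr0 eqxx.
have e0 : evalq 1 0 = 0 := takes_evalq (takes0 1).
have e1 : evalq 1 1 = 1 := takes_evalq (takes_qX 0).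
have := @qlift_product _ _ _ q_neq0 qT qS c
  (fun j => evalq 1 (V j 0 0)) (fun j => evalq 1 (V j 1 0))
  (fun j => V j 0 0) (fun j => V j 1 0) c0.
rewrite V0 V1 !mxE /= e0 e1 => /(_ erefl erefl erefl erefl).
move/(_ (evalq_lift_rec ^~ 0) (evalq_lift_rec ^~ 1) erefl erefl erefl erefl).
move/(_ (lift_rec ^~ 0) (lift_rec ^~ 1) j _ _ _ _ inf).
by rewrite !mul1r !mul0r !mulr0 !mul0r !subr0 => -[].
Qed.

Lemma Delta_lift_succ j :
  Delta (V j) (V (j + 1)) = q ^ ((c j)%:Z - 1) * Delta (V (j - 1)) (V j).
Proof. by rewrite !DeltaE !lift_rec; ring. Qed.

(** The determinant is 1 at [j = 0], and each step multiplies or divides it by a power of [q]. *)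
Lemma Delta_lift_neq0 j : Delta (V (j - 1)) (V j) != 0.
Proof.
elim/int_ind_succ_pred: j => [|j IH|j IH].
- by have [V1 V0 _] := hV; rewrite sub0r V1 V0 DeltaE !mxE /= mul1r mulr0 subr0 oner_eq0.
- by rewrite addrK Delta_lift_succ; apply: mulf_neq0; [exact: qX_neq0 | exact: IH].
- apply: contraNneq IH => D0.
  by have := Delta_lift_succ (j - 1); rewrite subrK D0 mulr0 => ->.
Qed.

Lemma gr_q_vertex i :
    qint (c i) * qint (c (i + 1)) - q ^ ((c i)%:Z - 1) != 0 ->
  q ^ ((c i)%:Z - 1) *
    gr_q (vertex V (i - 2)) (vertex V (i - 1)) (vertex V i) (vertex V (i + 1)) =
  qint (c i) * qint (c (i + 1)) - q ^ ((c i)%:Z - 1).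
Proof.
move=> N0; rewrite /gr_q /cr_q /cr.
(* The normalised lifts in [cr] differ from the [V_j] by nonzero scalars, which cancel in the
   cross-ratio. *)
have lift j : exists2 k, k != 0 & lift_of (qrat (vertex V j)) = k *: V j.
  have [Vj ->] := qlift_vertex j; have [k k0 ->] := lift_of_point Vj.
  exists k => //; congr (_ *: _); apply/matrixP=> r s; rewrite ord1 !mxE.
  by case: eqVneq => [->//|]; case: r => [[|[|r]] hr] //= _;
     congr (V _ _ _); apply/val_inj.
have [k1 k10 ->] := lift (i - 2); have [k2 k20 ->] := lift (i - 1).
have [k3 k30 ->] := lift i; have [k4 k40 ->] := lift (i + 1).
rewrite (cr_liftZ _ _ _ _ k10 k20 k30 k40).
have [_ _ Vj] := hV.
have e1 : i - 1 - 1 = i - 2 by lia.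
have e2 : i + 1 - 2 = i - 1 by lia.
apply: (cr_lift_recurrence (Vj i)).
- by rewrite Vj addrK e2.
- by rewrite -e1; exact: Delta_lift_neq0.
- exact: qX_neq0.
- exact: qX_neq0.
- exact: N0.
Qed.

End Polygon.

Lemma qint_mul_sub_qX_neq0 (c d : nat) : (c, d) != (1%N, 1%N) ->
  qint c * qint d - q ^ (c%:Z - 1) != 0.
Proof.
move=> cd; have t : takes 1 (qint c * qint d - q ^ (c%:Z - 1)) (c%:R * d%:R - 1).
  apply: takesD; first by apply: takesM; exact: takes_qint.
  by apply: takesN; exact: takes_qX.
apply: contraNneq cd => N0.
have := takes_evalq t; rewrite N0 (takes_evalq (takes0 1)) => /esym/eqP.
by rewrite subr_eq0 -natrM -[1]/(1%:R) eqr_nat muln_eq1 xpair_eqE.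
Qed.

(** * Triangulated polygons *)

Section Ears.

Variables (n : nat) (D : {set 'I_n * 'I_n}).
Hypotheses (n4 : (4 <= n)%N) (hD : triangulation D).
Implicit Types (a b t v w p r : 'I_n) (e f : 'I_n * 'I_n).

Let edge a b := side a b || ((a, b) \in D).

Lemma triangulation_diagonal e : e \in D -> (e.1 < e.2)%N /\ ~~ side e.1 e.2.
Proof.
have /maxsetP[/andP[/subsetP sub _] _] := hD.
by move/sub; rewrite inE => /andP.
Qed.

Lemma triangulation_noncrossing e f : e \in D -> f \in D -> ~~ crossing e f.
Proof.
have /maxsetP[/andP[_ /forall_inP nc] _] := hD.
by move=> eD fD; have /forall_inP := nc e eD; apply.
Qed.

(** Otherwise [e |: D] would be noncrossing, against maximality of [D]. *)
Lemma triangulation_maximal e : (e.1 < e.2)%N -> ~~ side e.1 e.2 ->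
  e \notin D -> exists2 f, f \in D & crossing e f.
Proof.
have /maxsetP[/andP[sub nc] mx] := hD.
move=> lt_e se eD; apply/exists_inP; apply: contraNT eD.
rewrite negb_exists_in => /forall_inP ncr.
have <- : e |: D = D; last by rewrite setU11.
apply: mx; last exact: subsetU1.
apply/andP; split; first by rewrite subUset sub1set inE lt_e se.
apply/forall_inP=> f /setU1P[->|fD]; apply/forall_inP=> g /setU1P[->|gD].
- by rewrite /crossing; lia.
- exact: ncr.
- by have := ncr f fD; rewrite /crossing orbC.
- exact: triangulation_noncrossing.
Qed.

(** A side has no vertex strictly inside one of its two arcs, so no diagonal crosses it. *)
Lemma edge_noncrossing a b p r : (a < b)%N -> edge a b -> (p, r) \in D ->
  ~~ crossing (a, b) (p, r).
Proof.
move=> ab /orP[sab prD|]; last exact: triangulation_noncrossing.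
have [/= pr _] := triangulation_diagonal prD.
have := ltn_ord r; have := ltn_ord b.
by move: sab; rewrite /side /crossing /=; lia.
Qed.

(* t is the neighbour of a closest to b. *)
Lemma inner_triangle a b : edge a b -> (a.+1 < b)%N ->
  exists t, [/\ (a < t)%N, (t < b)%N, edge a t & edge t b].
Proof.
move=> eab ab; have a1n : (a.+1 < n)%N by exact: ltn_trans (ltn_ord b).
pose P t := [&& a < t, t < b & edge a t]%N.
have Pa1 : P (Ordinal a1n).
  by rewrite /P /edge /side /= eqxx; lia.
case: (@arg_maxnP _ (Ordinal a1n) P (fun t => t) Pa1) => t /and3P[at_ tb eat] tmax.
exists t; split=> //; apply: contraT; rewrite negb_or => /andP[stb tbD].
(* A diagonal crossing [(t, b)] but neither [(a, b)] nor [(a, t)] must start at [a] and end strictly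
   between [t] and [b], against the choice of [t]. *)
have [[p r] prD] := @triangulation_maximal (t, b) tb stb tbD.
have [/= pr _] := triangulation_diagonal prD.
have := edge_noncrossing (ltnW ab) eab prD.
have := edge_noncrossing at_ eat prD.
rewrite /crossing /= => nc1 nc2 cr.
have [pa] : p = a /\ (t < r < b)%N.
  by clear - nc1 nc2 cr pr tb at_; split; [apply/val_inj => /= |]; lia.
case/andP=> tr rb; have := tmax r; rewrite /P /edge -pa prD orbT rb pr => /(_ isT).
by rewrite /= leqNgt tr.
Qed.

(* Apply [inner_triangle] to the shortest edge strictly enclosing (a, b). *)
Lemma outer_triangle a b : (a, b) \in D ->
  exists t, [/\ (t < a)%N, edge t a & edge t b] \/ [/\ (b < t)%N, edge a t & edge b t].
Proof.
move=> abD; have [/= ab sab] := triangulation_diagonal abD.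
have n0 : (0 < n)%N by lia.
have n1 : (n.-1 < n)%N by lia.
pose P (e : 'I_n * 'I_n) :=
  [&& e.1 <= a, b <= e.2, e != (a, b) & edge e.1 e.2]%N.
(* The side [(0, n-1)] encloses every diagonal, so the minimum exists. *)
have P0 : P (Ordinal n0, Ordinal n1).
  rewrite /P /edge /side /= !eqxx orbT /= xpair_eqE -!val_eqE /=.
  by move: sab (ltn_ord b); rewrite /side; lia.
case: (@arg_minnP _ _ P (fun e => e.2 - e.1)%N P0) => -[p r].
rewrite /P /= => /and4P[pa br neq epr] emin.
have pr : (p.+1 < r)%N.
  by move: neq; rewrite xpair_eqE -!val_eqE /=; lia.
have [t [pt tr ept etr]] := inner_triangle epr pr.
have nc1 := edge_noncrossing pt ept abD.
have nc2 := edge_noncrossing tr etr abD.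
(* If [t] lies outside [(a, b)], minimality forces [(t, r)] or [(p, t)] to be [(a, b)]; if it lies
   strictly inside, noncrossing forces [(p, r) = (a, b)], which is excluded. *)
have [ta|at_] := leqP t a.
  have : (t, r) = (a, b).
    apply/eqP; apply: contraT => neq'; have := emin (t, r).
    by rewrite /= neq' ta br etr => /(_ isT); clear - pt tr; lia.
  by case=> ta' rb; exists p; left; rewrite -rb -ta'.
have [bt|tb] := leqP b t.
  have : (p, t) = (a, b).
    apply/eqP; apply: contraT => neq'; have := emin (p, t).
    by rewrite /= neq' pa bt ept => /(_ isT); clear - pt tr; lia.
  by case=> pa' tb'; exists r; right; rewrite -tb' -pa'.
by move: nc1 nc2 neq; rewrite /crossing xpair_eqE -!val_eqE /=; lia.
Qed.

Lemma mem_triangles a b t : (a < b)%N -> (b < t)%N ->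
  edge a b -> edge b t -> edge a t -> [set a; b; t] \in triangles D.
Proof.
move=> ab bt eab ebt eat; rewrite inE; apply/andP; split.
  by rewrite -setUA !cardsU1 cards1 !inE -!val_eqE /=; lia.
apply/forall_inP=> x; rewrite !inE => hx; apply/forall_inP=> y; rewrite !inE => hy.
apply/implyP; case/orP: hx => [/orP[]|] /eqP->; case/orP: hy => [/orP[]|] /eqP-> //; lia.
Qed.

(** A diagonal bounds one triangle on each side; the apex [s] of the inner one is not a vertex of
    the outer one, so they differ. *)
Lemma diagonal_incident_triangles a b v : (a, b) \in D -> v \in [set a; b] ->
  (2 <= incident_triangles D v)%N.
Proof.
move=> abD vab; have [/= ab sab] := triangulation_diagonal abD.
have eab : edge a b by rewrite /edge abD orbT.
have ab1 : (a.+1 < b)%N by move: sab; rewrite /side; lia.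
have [s [as_ sb eas esb]] := inner_triangle eab ab1.
have sT := mem_triangles as_ sb eas esb eab.
have [T2 [T2T vT2 sT2]] : exists T2 : {set 'I_n},
    [/\ T2 \in triangles D, v \in T2 & s \notin T2].
  have [t [[ta eta etb]|[bt eat ebt]]] := outer_triangle abD.
    exists [set t; a; b]; split; first exact: mem_triangles.
      by case/set2P: vab => ->; rewrite !inE eqxx ?orbT.
    by clear - ta as_ sb; rewrite !inE -!val_eqE /=; lia.
  exists [set a; b; t]; split; first exact: mem_triangles.
    by case/set2P: vab => ->; rewrite !inE eqxx ?orbT.
  by clear - bt as_ sb; rewrite !inE -!val_eqE /=; lia.
have card2 : #|[set [set a; s; b]; T2]| = 2%N.
  rewrite cards2 (_ : _ != _) //; apply: contraNneq sT2 => <-.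
  by rewrite !inE eqxx orbT.
rewrite /incident_triangles -card2.
apply: subset_leq_card; apply/subsetP=> T /set2P[]->; rewrite inE.
  by rewrite sT; case/set2P: vab => ->; rewrite !inE eqxx ?orbT.
by rewrite T2T.
Qed.

(* If no diagonal ends at v, the short diagonal cutting off v belongs to D. *)
Lemma no_adjacent_ears v w : w = (v.+1 %% n)%N :> nat ->
  incident_triangles D v = 1%N -> incident_triangles D w <> 1%N.
Proof.
move=> wE cv cw.
have no_diag u a b : incident_triangles D u = 1%N -> (a, b) \in D ->
    (u != a :> nat) && (u != b :> nat).
  move=> cu abD; rewrite -negb_or; apply/negP => uab.
  have : u \in [set a; b] by rewrite !inE -!val_eqE.
  by move/(diagonal_incident_triangles abD); rewrite cu.
have vn := ltn_ord v; have wn := ltn_ord w.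
have {}wE : (v.+1 = n /\ w = 0%N :> nat) \/ ((v.+1 < n)%N /\ w = v.+1 :> nat).
  rewrite wE; have [vn1|vn1] := ltnP v.+1 n; first by right; rewrite modn_small.
  by left; rewrite (_ : v.+1 = n) ?modnn //; lia.
(* [x] and [y] are the two neighbours of [v], one of them [w]; the cases [v = 0] and [v = n-1]
   handle the cyclic wrap-around. *)
have [x [y [xy sxy wxy cut]]] : exists x y : 'I_n, [/\ (x < y)%N, ~~ side x y,
    (w == x :> nat) || (w == y :> nat) &
    forall p r, (p < r)%N -> crossing (x, y) (p, r) ->
      (v == p :> nat) || (v == r :> nat)].
  pose o k (hk : (k < n)%N) := Ordinal hk.
  have [v0|v0] := eqVneq (v : nat) 0%N.
    have h1 : (1 < n)%N by lia.
    have h2 : (n.-1 < n)%N by lia.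
    exists (o _ h1), (o _ h2); rewrite /side /crossing /=; split; try lia.
    by move=> p r; have := ltn_ord r; lia.
  have [vl|vl] := eqVneq (v : nat) n.-1.
    have h1 : (0 < n)%N by lia.
    have h2 : (n.-2 < n)%N by lia.
    exists (o _ h1), (o _ h2); rewrite /side /crossing /=; split; try lia.
    by move=> p r; have := ltn_ord r; lia.
  have h1 : (v.-1 < n)%N by lia.
  have h2 : (v.+1 < n)%N by lia.
  exists (o _ h1), (o _ h2); rewrite /side /crossing /=; split; try lia.
(* This diagonal would end at [w], an ear. Maximality then yields a diagonal crossing it, which has
   to end at [v], also an ear. *)
have xyD : (x, y) \notin D.
  by apply/negP => /(no_diag _ _ _ cw); move: wxy; lia.
have [[p r] prD cr] := @triangulation_maximal (x, y) xy sxy xyD.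
have [/= pr _] := triangulation_diagonal prD.
have := cut _ _ pr cr; have := no_diag _ _ _ cv prD; lia.
Qed.

End Ears.

Lemma quiddity_no_adjacent_ears (n : nat) (c : int -> nat) (i : int) :
  (4 <= n)%N -> quiddity_sequence n c -> (c i, c (i + 1)) != (1%N, 1%N).
Proof.
move=> n4 [D hD cE]; have n0 : n%:Z != 0 by lia.
pose r (j : int) := absz (j %% n%:Z)%Z.
have rE j : (r j)%:Z = (j %% n%:Z)%Z by rewrite gez0_abs ?modz_ge0.
have rlt j : (r j < n)%N.
  by rewrite -ltz_nat rE ltz_pmod //; lia.
have cr j : c j = incident_triangles D (Ordinal (rlt j)).
  by apply: cE; rewrite /= rE modz_mod.
rewrite !cr; apply/eqP=> -[/(no_adjacent_ears n4 hD) h1]; apply: h1 => /=.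
by apply/eqP; rewrite -eqz_nat rE -modz_nat -addn1 PoszD rE modzDml.
Qed.

Unset Implicit Arguments.

Theorem theorem1p1 (n : nat) (c : int -> nat) (C : int -> int -> Qq)
    (V : int -> 'cV[Qq]_2) :
  (5 <= n)%N ->
  quiddity_sequence n c -> c 0 = 1%N ->
  is_q_frieze n c C ->
  is_polygon_lift c V ->
  forall i : int,
    C i (i + 1) =
      q ^ ((c i)%:Z - 1) *
      gr_q (vertex V (i - 2)) (vertex V (i - 1)) (vertex V i) (vertex V (i + 1)).
Proof.
move=> n5 hc c0 [C1 C0 CD] hV i.
have cc := quiddity_no_adjacent_ears i (ltnW n5) hc.
rewrite (gr_q_vertex c0 hV (qint_mul_sub_qX_neq0 cc)).
(* At [j = i + 1] the exponent is [c_i - 1] and [C_{i+1,i} = 1], so the diamond rule reads [[c_i]_q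
   [c_{i+1}]_q - C_{i,i+1} = q^(c_i - 1)]. *)
have /CD : i + 1 <= i + 1 <= i + n%:Z - 3 by lia.
have -> : absz (i + 1 - i)%R = 1%N by lia.
have C1i := C1 (i + 1).
rewrite addrK in C1i *; rewrite big_ord1 addr0 !C0 C1i mul1r => <-.
by rewrite subKr.
Qed.
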